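(* Let $\epsilon\in(0,\gamma]$. The $\epsilon$-obstacle tug-of-war game has a unique value, i.e. $u_I^\epsilon=u_{II}^\epsilon=:u^\epsilon$ on $\Omega\cup\Gamma$. This value is the solution to the discrete obstacle problem; that is, it satisfies $$u^\epsilon(x)\geq \frac12\sup_{y\in B_\epsilon(x)}u^\epsilon(y)+\frac12\inf_{y\in B_\epsilon(x)}u^\epsilon(y)\qquad\text{for all }x\in\Omega,$$ $u^\epsilon\ge\Psi$ in $\Omega$, $u^\epsilon=F$ in $\Gamma$, and the displayed inequality is an equality at every $x\in\Omega$ with $u^\epsilon(x)>\Psi(x)$.
   Context: Setting. $\Omega\subset\mathbb R^N$ is a bounded smooth domain, $\gamma>0$ is fixed, and $\Gamma=\{x\in\mathbb R^N\setminus\Omega:\operatorname{dist}(x,\partial\Omega)\le\gamma\}$. The final payoff $F:\Gamma\to\mathbb R$ is Lipschitz, and the obstacle $\Psi:\mathbb R^N\to\mathbb R$ is Lipschitz with $\Psi\le F$ in $\Gamma$. $B_\epsilon(x)$ is the ball of radius $\epsilon$ centered at $x$. The $\epsilon$-obstacle tug-of-war game ($0<\epsilon\le\gamma$). A token starts at $x_0$. If $x_0\in\Gamma$ the game ends at once. At each stage $k$ with $x_k\in\Omega$, Player I may end the game; otherwise each player $i\in\{I,II\}$ chooses an action $a_k^i\in B_\epsilon(x_k)$, a fair coin is tossed, and $x_{k+1}=a_k^I$ or $x_{k+1}=a_k^{II}$ with probability $1/2$ each. The game also ends when the token reaches $\Gamma$. When the game ends at position $x_\tau$, Player II pays Player I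 the amount $\tilde F(x_\tau)$, where $\tilde F=F$ on $\Gamma$ and $\tilde F=\Psi$ on $\Omega$. A strategy $S_i$ of Player $i$ is a sequence of Borel-measurable maps sending each history $(x_0,a_0,x_1,\dots,a_{k-1},x_k)$ (where $a_j=(a_j^I,a_j^{II})$) to a point of $B_\epsilon(x_k)$. A stopping rule $\tau$ for Player I is a finite, Borel-measurable stopping time with values in $\mathbb N=\{0,1,2,\dots\}$ with respect to the histories ($\tau=k$ means that Player I ends the game at stage $k$, if it has not ended already). These data induce a probability on plays with expectation $\mathbb E^{x_0}_{\tau,S_I,S_{II}}$. Let $V_{x_0,I}(\tau,S_I,S_{II})=V_{x_0,II}(\tau,S_I,S_{II})=\mathbb E^{x_0}_{\tau,S_I,S_{II}}[\tilde F(x_\tau)]$ ($x_\tau$ the terminal position) if the game terminates almost surely, and otherwise $V_{x_0,I}=-\infty$, $V_{x_0,II}=+\infty$. The values for the two players are $$u_I^\epsilon(x_0)=\sup_{\tau,S_I}\inf_{S_{II}}V_{x_0,I}(\tau,S_I,S_{II}),\qquad u_{II}^\epsilon(x_0)=\inf_{S_{II}}\sup_{\tau,S_I}V_{x_0,II}(\tau,S_I,S_{II}).$$ *)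

(* Defs.v *)
From HB Require Import structures.
From mathcomp Require Import all_boot all_order all_algebra.
From mathcomp Require Import zify.
From mathcomp Require Import all_classical all_reals all_analysis.

Set Implicit Arguments.
Unset Strict Implicit.
Unset Printing Implicit Defensive.

Import Order.TTheory GRing.Theory Num.Theory.
Import numFieldNormedType.Exports.

Local Open Scope classical_set_scope.
Local Open Scope ring_scope.

(* The library norm on matrices is the sup norm; balls, distances and Lipschitz
   constants below are Euclidean. *)
Definition enorm (R : realType) (N : nat) (x : 'rV[R]_N) : R :=
  Num.sqrt (\sum_(i < N) x ord0 i ^+ 2).

Definition eball (R : realType) (N : nat) (x : 'rV[R]_N) (r : R) :
    set 'rV[R]_N :=
  [set y | enorm (y - x) < r].

Definition edist (R : realType) (N : nat) (x : 'rV[R]_N) (A : set 'rV[R]_N) : R :=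
  inf [set enorm (x - y) | y in A].

Definition elipschitz_on (R : realType) (N : nat) (A : set 'rV[R]_N)
    (f : 'rV[R]_N -> R) : Prop :=
  exists K : R, forall x y, A x -> A y -> `|f x - f y| <= K * enorm (x - y).

Fixpoint Ck (R : realType) (n k : nat) (f : 'rV[R]_n -> R) : Prop :=
  if k is k'.+1 then
    continuous f /\
    forall i : 'I_n, (forall x, derivable f x (delta_mx ord0 i)) /\
                     Ck k' ('D_(delta_mx ord0 i) f)
  else continuous f.

Definition Cinfty (R : realType) (n : nat) (f : 'rV[R]_n -> R) : Prop :=
  forall k, Ck k f.

Definition frontier (T : topologicalType) (A : set T) : set T :=
  closure A `\` interior A.

(* Near each boundary point, after relabelling the axes (choice of i) and
   possibly reversing the i-th one (s = true), Omega is the region above the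
   graph of a smooth function g of the remaining N - 1 coordinates. *)
Definition smooth_frontier (R : realType) (N : nat) (Omega : set 'rV[R]_N) : Prop :=
  forall p, frontier Omega p ->
    exists (r : R) (i : 'I_N) (s : bool) (g : 'rV[R]_N.-1 -> R),
      [/\ 0 < r, Cinfty g &
          forall x, eball p r x ->
            (Omega x <-> g (col' i x) < (-1) ^+ s * x ord0 i)].

Definition bounded_smooth_domain (R : realType) (N : nat)
    (Omega : set 'rV[R]_N) : Prop :=
  [/\ Omega !=set0, open Omega, connected Omega,
      (exists M : R, forall x, Omega x -> enorm x <= M) &
      smooth_frontier Omega].

Definition strip (R : realType) (N : nat) (Omega : set 'rV[R]_N) (gamma : R) :
    set 'rV[R]_N :=
  [set x | ~ Omega x /\ edist x (frontier Omega) <= gamma].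

(* Borel sigma-algebra of R^N *)
HB.instance Definition _ (R : realType) (N : nat) :=
  @isMeasurable.Build default_measure_display 'rV[R]_N <<s @open 'rV[R]_N >>
    (@sigma_algebra0 _ setT open)
    (@sigma_algebraC _ open)
    (@sigma_algebra_bigcup _ setT open).

(* The stage data (x_k, (a_k^I, a_k^II)) *)
Notation stage R N := ('rV[R]_N * ('rV[R]_N * 'rV[R]_N))%type.

(* The history (x_0, a_0, x_1, ..., a_{k-1}, x_k), grouped as
   ((x_0, a_0), ..., (x_{k-1}, a_{k-1})) and x_k *)
Notation history R N k := (k.-tuple (stage R N) * 'rV[R]_N)%type.

Notation play R N := (nat -> stage R N).

Definition pos (R : realType) (N : nat) (p : play R N) (k : nat) : 'rV[R]_N :=
  (p k).1.

Definition past (R : realType) (N : nat) (k : nat) (p : play R N) : history R N k :=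
  ([tuple p i | i < k], pos p k).

Record strategy (R : realType) (N : nat) (eps : R) := Strategy {
  action :> forall k, history R N k -> 'rV[R]_N ;
  action_measurable : forall k, measurable_fun [set: history R N k] (@action k) ;
  action_ball : forall k (h : history R N k), eball h.2 eps (action h) }.

Record stopping_rule (R : realType) (N : nat) := StoppingRule {
  stop_time :> play R N -> nat ;
  stop_time_adapted : forall k, exists2 A : set (history R N k),
    measurable A & [set p | stop_time p = k] = @past R N k @^-1` A }.

(* The fair coin tosses are the binary digits of a uniform point of [0, 1];
   see fair_coins below. *)
Definition coin_prob (R : realType) : probability (measurableTypeR R) R :=
  uniform_prob (@ltr01 R).

Definition coin (R : realType) (w : R) (k : nat) : bool :=
  odd `|Num.floor (2 ^+ k.+1 * w)|%N.

Lemma coin_floorP (R : realType) (b : nat -> bool) (n : nat) (w : R) :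
  0 <= w < 1 ->
  (forall k, (k < n)%N -> coin w k = b k) <->
  Num.floor (2 ^+ n * w) = (\sum_(k < n) b k * 2 ^ (n.-1 - k))%N%:Z.
Proof.
move=> /andP[w0 w1].
have split2 (y : R) : 0 <= y ->
    Num.floor (2 * y) =
    Num.floor y * 2 + (odd `|Num.floor (2 * y)|%N)%:Z.
  move=> y0.
  have f0 : (0 <= Num.floor y)%R by rewrite floor_ge0.
  have /andP[l u] := floor_itv y.
  have [h|h] := ltP (2 * y) ((Num.floor y * 2 + 1)%:~R).
    have E : Num.floor (2 * y) = Num.floor y * 2.
      apply/floor_def/andP; split=> //.
      by rewrite intrM mulrC ler_pM2l.
    by rewrite E abszM oddM andbF addr0.
  have E : Num.floor (2 * y) = Num.floor y * 2 + 1.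
    apply/floor_def/andP; split=> //.
    rewrite -addrA (_ : 1 + 1 = 1 * 2)%R// -mulrDl intrM mulrC.
    by rewrite ltr_pM2r.
  rewrite E; congr (_ + _); case: (Num.floor y) f0 => // q _.
  by rewrite -PoszM -PoszD absz_nat oddD oddM andbF.
elim: n => [|n IH].
  rewrite big_ord0 expr0 mul1r; split=> // _.
  by apply/floor_def; rewrite w0.
have Sn : (\sum_(k < n.+1) b k * 2 ^ (n - k) =
    (\sum_(k < n) b k * 2 ^ (n.-1 - k)) * 2 + b n)%N.
  rewrite big_ord_recr/= subnn expn0 muln1 big_distrl/=; congr addn.
  apply: eq_bigr => -[k kn] _ /=; case: n kn {IH} => // n kn.
  by rewrite /= subSn// expnSr mulnA.
rewrite /= Sn.
have Ef : Num.floor (2 ^+ n.+1 * w) =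
    Num.floor (2 ^+ n * w) * 2 + (coin w n)%:Z.
  rewrite /coin exprS -mulrA; apply: split2.
  by rewrite mulr_ge0// exprn_ge0.
have f0 : (0 <= Num.floor (2 ^+ n * w))%R.
  by rewrite floor_ge0 mulr_ge0// exprn_ge0.
rewrite Ef; split=> [H|].
  rewrite H// IH.1; first by rewrite PoszD PoszM.
  by move=> k kn; apply: H; rewrite ltnS ltnW.
move: (Num.floor _) f0 IH => [] // f _ IH.
rewrite -PoszM -PoszD => -[] E.
have Eo : coin w n = b n.
  by have := congr1 odd E; rewrite !oddD !oddM !andbF/= !oddb.
move=> k; rewrite ltnS leq_eqVlt => /orP[/eqP ->//|kn].
apply: (IH.2 _ k kn); congr Posz.
by move: E; rewrite Eo => /addIn /eqP; rewrite eqn_mul2r => /eqP.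
Qed.

Lemma fair_coins (R : realType) (b : nat -> bool) (n : nat) :
  coin_prob R [set w | forall k, (k < n)%N -> coin w k = b k] =
  (2^-1 ^+ n)%:E.
Proof.
set U := [set w | _]; set m := (\sum_(k < n) b k * 2 ^ (n.-1 - k))%N.
have p0 : 0 < 2 ^+ n :> R by rewrite exprn_gt0.
have m1 : (m < 2 ^ n)%N.
  rewrite /m; elim: n {U p0 m} => [|n IH]; first by rewrite big_ord0.
  rewrite big_ord_recr/= subnn muln1.
  have -> : (\sum_(i < n) b i * 2 ^ (n - i) =
      2 * \sum_(k < n) b k * 2 ^ (n.-1 - k))%N.
    rewrite big_distrr/=; apply: eq_bigr => -[k kn] _ /=.
    by case: n kn {IH} => // n kn; rewrite /= subSn// expnS mulnCA.
  by rewrite expnS; case: (b n) IH; lia.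
pose I : set R := [set` `[m%:R / 2 ^+ n, (m%:R + 1) / 2 ^+ n[].
have UI : U `&` `[0, 1] = I `|` (U `&` [set 1]).
  apply/seteqP; split=> [x [Ux]|x].
    rewrite /= in_itv/= => /andP[x0]; rewrite le_eqVlt => /orP[/eqP x1|x1].
      by right.
    left; rewrite /I/= in_itv/=.
    have /coin_floorP := Ux; rewrite x0 x1 => /(_ isT) E.
    have := floor_itv (2 ^+ n * x).
    rewrite E -/m intrD -!pmulrn.
    by rewrite ler_pdivrMr// ltr_pdivlMr// (mulrC x).
  case=> [|[Ux x1]]; last first.
    by split=> //; rewrite x1 /= in_itv/= ler01 lexx.
  rewrite /I/= in_itv/= ler_pdivrMr// ltr_pdivlMr// => /andP[l u].
  have x01 : 0 <= x < 1.
    rewrite -(pmulr_lge0 _ p0) (le_trans _ l)//=.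
    rewrite -(ltr_pM2r p0) mul1r (lt_le_trans u)//.
    by rewrite natr1 -natrX ler_nat.
  split; last by rewrite /= in_itv/=; case/andP: x01 => -> /ltW ->.
  apply/coin_floorP => //; apply/floor_def.
  by rewrite intrD -!pmulrn mulrC l u.
rewrite [LHS]integral_uniform_pdf.
have mI : measurable I by exact: measurable_itv.
have US : U `&` [set 1] = set0 \/ U `&` [set 1] = [set 1].
  have [U1|U1] := pselect (U 1).
    by right; apply/seteqP; split=> [x []//|x ->]; split.
  by left; apply/seteqP; split=> // x [Ux x1]; apply: U1; rewrite -x1.
have mS : measurable (U `&` [set 1]).
  by case: US => ->; [exact: measurable0|exact: measurable_set1].
have S0 : lebesgue_measure (U `&` [set 1]) = 0%E :> \bar R.
  by case: US => ->; [rewrite measure0|rewrite lebesgue_measure_set1].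
rewrite (eq_integral (fun=> 1%E)); last first.
  move=> x; rewrite inE => -[_]; rewrite /= in_itv/= => x01.
  by rewrite /uniform_pdf x01 subr0 invr1.
rewrite UI integral_cst ?mul1e; last exact: measurableU.
rewrite measureU0//.
rewrite [LHS]lebesgue_measure_itv/= lte_fin ltr_pM2r ?invr_gt0// ltrDl ltr01.
by rewrite -EFinB -mulrBl addrAC subrr add0r mul1r exprVn.
Qed.

Section game.
Context (R : realType) (N : nat) (eps : R) (Omega Gamma : set 'rV[R]_N)
  (F Psi : 'rV[R]_N -> R).

(* The play is formally continued after the game is over; only its part up to
   terminal_time matters. A toss c k = true selects Player I's action. *)
Fixpoint play_history (x0 : 'rV[R]_N) (SI SII : strategy N eps) (c : nat -> bool)
    (k : nat) : history R N k :=
  if k is k'.+1 then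
    let h := play_history x0 SI SII c k' in
    let a := (SI k' h, SII k' h) in
    ([tuple of rcons h.1 (h.2, a)], if c k' then a.1 else a.2)
  else ([tuple], x0).

Definition play_of (x0 : 'rV[R]_N) (SI SII : strategy N eps) (c : nat -> bool) :
    play R N :=
  fun k => let h := play_history x0 SI SII c k in (h.2, (SI k h, SII k h)).

Definition over_at (tau : stopping_rule R N) (p : play R N) (k : nat) : Prop :=
  Gamma (pos p k) \/ tau p = k.

Definition terminates (tau : stopping_rule R N) (p : play R N) : Prop :=
  exists k, over_at tau p k.

Definition terminal_time (tau : stopping_rule R N) (p : play R N) : nat :=
  get [set k | over_at tau p k /\ forall j, over_at tau p j -> (k <= j)%N].

Definition final_payoff (x : 'rV[R]_N) : R := if x \in Gamma then F x else Psi x.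

Definition terminates_as (x0 : 'rV[R]_N) (tau : stopping_rule R N)
    (SI SII : strategy N eps) : Prop :=
  {ae coin_prob R, forall w, terminates tau (play_of x0 SI SII (coin w))}.

Definition expected_payoff (x0 : 'rV[R]_N) (tau : stopping_rule R N)
    (SI SII : strategy N eps) : \bar R :=
  ('E_(coin_prob R)[fun w =>
     let p := play_of x0 SI SII (coin w) in
     final_payoff (pos p (terminal_time tau p))])%E.

Definition V_I (x0 : 'rV[R]_N) (tau : stopping_rule R N)
    (SI SII : strategy N eps) : \bar R :=
  if `[< terminates_as x0 tau SI SII >] then expected_payoff x0 tau SI SII
  else -oo%E.

Definition V_II (x0 : 'rV[R]_N) (tau : stopping_rule R N)
    (SI SII : strategy N eps) : \bar R :=
  if `[< terminates_as x0 tau SI SII >] then expected_payoff x0 tau SI SII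
  else +oo%E.

Definition u_I (x0 : 'rV[R]_N) : \bar R :=
  ereal_sup [set ereal_inf [set V_I x0 s.1 s.2 SII | SII in [set: strategy N eps]]
            | s in [set: stopping_rule R N * strategy N eps]].

Definition u_II (x0 : 'rV[R]_N) : \bar R :=
  ereal_inf [set ereal_sup [set V_II x0 s.1 s.2 SII
                           | s in [set: stopping_rule R N * strategy N eps]]
            | SII in [set: strategy N eps]].

(* Extended sup and inf are used because the real ones default to 0 on unbounded
   sets. *)
Definition ball_midrange (u : 'rV[R]_N -> R) (x : 'rV[R]_N) : \bar R :=
  (2^-1%:E * ereal_sup [set (u y)%:E | y in eball x eps] +
   2^-1%:E * ereal_inf [set (u y)%:E | y in eball x eps])%E.

Definition discrete_obstacle_solution (u : 'rV[R]_N -> R) : Prop :=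
  [/\ forall x, Omega x -> ((u x)%:E >= ball_midrange u x)%E,
      forall x, Omega x -> Psi x <= u x,
      forall x, Gamma x -> u x = F x &
      forall x, Omega x -> Psi x < u x -> (u x)%:E = ball_midrange u x].

End game.

(* Main.v *)
Require Import Defs.
From mathcomp Require Import all_boot all_order all_algebra.
From mathcomp Require Import ring lra zify.
From mathcomp Require Import all_classical all_reals all_analysis.
From mathcomp Require Import measurable_realfun.

Set Implicit Arguments.
Unset Strict Implicit.
Unset Printing Implicit Defensive.

Import Order.TTheory GRing.Theory Num.Theory.
Import numFieldNormedType.Exports.

Local Open Scope classical_set_scope.
Local Open Scope ring_scope.

(** The value is the least solution [W] of the discrete obstacle problem. Let
[T v] be [F] on [Gamma] and the maximum of [Psi] and of the midrange of [v] over
the ball of radius [eps] on [Omega]. This operator is monotone, so the infimum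
[W] of its bounded supersolutions is a fixed point
([least_supersolution_fix]), and a bounded fixed point solves the obstacle
problem. It remains to squeeze both values of the game, for which
[u_I <= u_II] always holds, between [W] and [W].

Upper bound ([u_II_le]). Player II moves to an almost minimal point of [W] in the
ball, with summable errors. Then [W] along the play is a supermartingale up to
these errors, whatever Player I does, and it dominates the payoff when the game
ends. Since stopping rules are finite on all plays, the duration of the game is
bounded for each choice of strategies by the fan theorem ([fan_bound]), so that
the expectation is a finite average over coin tosses ([expectation_coin_avg]) and
only finite sums occur.

Lower bound ([horizon_value_le_u_I], [horizon_value_converges]). Starting from
[Psi], the iterates of [T] are values that Player I can secure up to any error by
stopping within a fixed number of rounds. They increase, and they converge to
[W] uniformly ([iterates_converge]). This is where the argument is not formal,
as the infimum over a ball does not commute with increasing limits. Suppose that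
the largest gap between [W] and the iterates decreases to some [M > 0]. Where a
late gap is almost [M], one has [W > Psi], so [W] equals its midrange, and the
gap between the suprema over the ball, as well as that between the infima, is
again almost [M] one stage earlier. Moving to an almost maximal point of [W]
keeps the gap and the slope of [W], so a definite slope would make [W] exceed its
bound ([near_max_flat]). Hence [W] is almost constant on the ball, and the gap is
almost [M] on all of it. Repeating this along a straight path that leaves [Omega]
in a bounded number of moves ([near_max_spreads]) carries a gap close to [M] to
[Gamma], where there is none.

Strategies and stopping rules have to be Borel. The supremum over open balls of
any bounded function is lower semicontinuous, so almost maximal points can be
chosen in a Borel way from a countable set, in the order of an enumeration
([measurable_near_maximizer]). Player I's stopping regions compare a midrange with
[Psi], so they are Borel too. *)

(** * Sup and inf over neighbourhoods *)

Section neighbourhoods.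
Context (R : realType) (T : Type) (B : T -> set T).
Implicit Types (u v w : T -> R) (x y : T).

Definition nbhd_sup u x : R := sup (u @` B x).
Definition nbhd_inf u x : R := inf (u @` B x).
Definition midrange u x : R := 2^-1 * nbhd_sup u x + 2^-1 * nbhd_inf u x.

Definition bounded_by (C : R) u := forall x, `|u x| <= C.

Hypothesis Brefl : forall x, B x x.

Lemma bounded_by_has_sup C u x : bounded_by C u -> has_sup (u @` B x).
Proof.
move=> bu; split; first by exists (u x), x.
by exists C => _ [y _ <-]; rewrite (le_trans (ler_norm _)).
Qed.

Lemma bounded_by_has_inf C u x : bounded_by C u -> has_inf (u @` B x).
Proof.
move=> bu; split; first by exists (u x), x.
by exists (- C) => _ [y _ <-]; rewrite lerNl (le_trans (ler_norm _))// normrN.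
Qed.

Lemma le_nbhd_sup C u x y : bounded_by C u -> B x y -> u y <= nbhd_sup u x.
Proof.
move=> bu xy; apply: sup_upper_bound; last by exists y.
exact: bounded_by_has_sup bu.
Qed.

Lemma nbhd_inf_le C u x y : bounded_by C u -> B x y -> nbhd_inf u x <= u y.
Proof.
move=> bu xy; apply: ge_inf; last by exists y.
by have [] := bounded_by_has_inf x bu.
Qed.

Lemma nbhd_sup_le u x (c : R) : (forall y, B x y -> u y <= c) -> nbhd_sup u x <= c.
Proof.
by move=> uc; apply: ge_sup => [|_ [y xy <-]]; [exists (u x), x|exact: uc].
Qed.

Lemma le_nbhd_inf u x (c : R) : (forall y, B x y -> c <= u y) -> c <= nbhd_inf u x.
Proof.
by move=> uc; apply: lb_le_inf => [|_ [y xy <-]]; [exists (u x), x|exact: uc].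
Qed.

Lemma nbhd_sup_near C u x (e : R) : bounded_by C u -> 0 < e ->
  exists2 y, B x y & nbhd_sup u x - e < u y.
Proof.
move=> bu e0; have [_ [y xy <-]] := sup_adherent e0 (bounded_by_has_sup x bu).
by exists y.
Qed.

Lemma nbhd_infE u x : nbhd_inf u x = - nbhd_sup (fun y => - u y) x.
Proof. by rewrite /nbhd_inf /inf image_comp. Qed.

Lemma midrange_le C u v x : bounded_by C u -> bounded_by C v ->
  (forall y, B x y -> u y <= v y) -> midrange u x <= midrange v x.
Proof.
move=> bu bv uv; apply: lerD; rewrite ler_pM2l ?invr_gt0//.
  apply: nbhd_sup_le => y xy; apply: (le_trans (uv _ xy)).
  exact: le_nbhd_sup bv xy.
apply: le_nbhd_inf => y xy; apply: le_trans (uv _ xy).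
exact: nbhd_inf_le bu xy.
Qed.

Lemma normr_midrange C u x : bounded_by C u -> `|midrange u x| <= C.
Proof.
move=> bu.
have Cu y : - C <= u y <= C by rewrite -ler_norml.
have s1 : nbhd_sup u x <= C by apply: nbhd_sup_le => y _; case/andP: (Cu y).
have i1 : - C <= nbhd_inf u x by apply: le_nbhd_inf => y _; case/andP: (Cu y).
have s2 := le_nbhd_sup bu (Brefl x); have i2 := nbhd_inf_le bu (Brefl x).
by have := Cu x; rewrite /midrange ler_norml; lra.
Qed.

(** * Convergence of the finite-horizon values *)

Section convergence.
Context (Om : set T) (v : T -> R) (u : nat -> T -> R) (C : R).
Hypothesis Bsym : forall x y, B x y -> B y x.
Hypothesis bv : bounded_by C v.
Hypothesis bu : forall n, bounded_by C (u n).
Hypothesis u_mono : forall n x, u n x <= u n.+1 x.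
Hypothesis u_step : forall n x, Om x -> midrange (u n) x <= u n.+1 x.
Hypothesis v_sub : forall n x, Om x -> u n x < v x -> v x <= midrange v x.
Hypothesis v_bdry : forall n x y, Om x -> B x y -> ~ Om y -> v y <= u n y.

Let gap n x := v x - u n x.
Let slope x := nbhd_sup v x - v x.

Section limit_gap.
Context (M : R).
Hypothesis M0 : 0 < M.

Let gap_le n0 (a : R) := forall n, (n0 <= n)%N -> forall x, Om x -> gap n x <= M + a.

Let gap_leW n0 n1 a b : (n0 <= n1)%N -> a <= b -> gap_le n0 a -> gap_le n1 b.
Proof.
move=> n01 ab h n n1n x ox; rewrite (le_trans (h n (leq_trans n01 n1n) x ox))//.
by rewrite lerD2l.
Qed.

Lemma near_max_slope n x y : Om x -> u n x < v x -> B x y -> `|v y - v x| <= slope x.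
Proof.
move=> ox uv xy; have := v_sub ox uv.
have := le_nbhd_sup bv xy; have := nbhd_inf_le bv xy.
by rewrite /slope /midrange ler_norml; lra.
Qed.

(** If the gap at stage [n.+1] is almost [M] at [x] while the gaps at stage [n]
do not exceed [M] by much, then neither the supremum nor the infimum over the
neighbourhood can have closed its own gap. *)
Lemma gap_neighbour n x y (a : R) : a < M -> gap_le n a -> Om x ->
  M - a <= gap n.+1 x -> B x y ->
  M - 3 * a - (nbhd_sup v x - v y) <= gap n y.
Proof.
move=> aM ga ox; rewrite /gap => gx xy.
have vm : v x <= midrange v x by apply: (@v_sub n.+1) => //; lra.
have um := u_step n ox; have uy := le_nbhd_sup (bu n) xy.
have iuv : nbhd_inf v x - (M + a) <= nbhd_inf (u n) x.
  apply: le_nbhd_inf => z xz; have iz := nbhd_inf_le bv xz.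
  have [oz|oz] := pselect (Om z).
    by have := ga n (leqnn n) z oz; rewrite /gap; lra.
  have := v_bdry n ox xz oz; have := ga n (leqnn n) x ox; rewrite /gap.
  by have := u_mono n x; lra.
by move: vm um; rewrite /midrange; lra.
Qed.

Lemma near_max_inside n x y (a : R) : Om x -> B x y -> a < M -> M - a <= gap n y ->
  Om y.
Proof.
move=> ox xy aM dy; apply: contrapT => oy.
by have := v_bdry n ox xy oy; move: dy; rewrite /gap; lra.
Qed.

(** Going to an almost maximal point of [v] in the neighbourhood costs one stage,
quadruples the deficit at worst, and loses none of the slope, because the
neighbour sees the point it comes from. *)
Lemma climb k n x (a D s : R) : 0 < a -> 4 ^+ k * a <= D -> D < M ->
  gap_le n a -> Om x -> M - a <= gap (n + k) x -> s <= slope x ->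
  exists2 y, Om y & v x + k%:R * (s - k%:R * D) <= v y.
Proof.
elim: k x a s => [|k IH] x a s a0; first by exists x; rewrite // mul0r addr0.
move=> aD DM ga ox; rewrite addnS => gx sx.
have a4 : 4 * a <= D.
  apply: le_trans aD; rewrite exprSr -mulrA ler_peMl ?exprn_ege1 ?ler1n//; lra.
have [y xy vy] := nbhd_sup_near x bv a0.
have aM : a < M by lra.
have gy : M - 4 * a <= gap (n + k) y.
  have := gap_neighbour aM (gap_leW (leq_addr k n) (lexx a) ga) ox gx xy.
  by lra.
have a4M : 4 * a < M by lra.
have oy : Om y by exact: near_max_inside ox xy a4M gy.
have sy : s - D <= slope y.
  have uvy : u (n + k) y < v y by move: gy; rewrite /gap; lra.
  have := near_max_slope oy uvy (Bsym xy).
  by rewrite ler_norml => /andP[+ _]; move: sx vy; rewrite /slope; lra.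
have a40 : 0 < 4 * a by lra.
have a4D : 4 ^+ k * (4 * a) <= D by rewrite mulrA -exprSr.
have ga4 : gap_le n (4 * a) by apply: gap_leW (leqnn n) _ ga; lra.
have [z oz vz] := IH y (4 * a) (s - D) a40 a4D DM ga4 oy gy sy.
exists z => //; apply: le_trans vz.
rewrite -natr1; move: sx vy; rewrite /slope.
have -> : s - D - k%:R * D = s - (k%:R + 1) * D by ring.
rewrite mulrDl mul1r; have : 0 <= k%:R * D by rewrite mulr_ge0//; lra.
by nra.
Qed.

(** A slope [s] that persists would lift [v] above its bound in finitely many
steps, so almost maximal points of a late gap are flat. *)
Lemma near_max_flat (s : R) : 0 < s -> exists2 a, 0 < a & exists k, forall n,
  gap_le n a -> forall x, Om x -> M - a <= gap (n + k) x -> slope x < s.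
Proof.
move=> s0.
(* k.+1 steps gain at least k.+1 * (s / 2), more than the oscillation 2 * C. *)
have [k kC] : exists k : nat, 4 * C < k.+1%:R * s.
  exists (Num.truncn (4 * C / s)).
  by rewrite -ltr_pdivrMr// truncnS_gt.
pose D := Num.min (s / (2 * k.+1%:R)) (M / 2).
have k0 : 0 < k.+1%:R :> R by [].
have D0 : 0 < D by rewrite lt_min !divr_gt0// mulr_gt0.
have Ds : k.+1%:R * D <= s / 2.
  by rewrite mulrC -ler_pdivlMr// -mulrA -invfM ge_min lexx.
have DM : D < M by rewrite gt_min; apply/orP; right; have := M0; lra.
have a0 : 0 < D / 4 ^+ k.+1 by rewrite divr_gt0// exprn_gt0.
have aD : 4 ^+ k.+1 * (D / 4 ^+ k.+1) <= D.
  by rewrite mulrCA divff ?mulr1// expf_neq0.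
exists (D / 4 ^+ k.+1) => //; exists k.+1 => n ga x ox gx.
rewrite ltNge; apply/negP => sx.
have [y oy] := climb a0 aD DM ga ox gx sx.
have : k.+1%:R * (s / 2) <= k.+1%:R * (s - k.+1%:R * D).
  by rewrite ler_pM2l//; lra.
have := bv x; have := bv y; rewrite !ler_norml.
by lra.
Qed.

(** Where [v] is flat the gap stays almost maximal on the whole neighbourhood, so
along a path of bounded length one never leaves [Om]. *)
Lemma near_max_spreads m : exists2 a, 0 < a & exists k, forall n, gap_le n a ->
  forall l, (n + k <= l)%N -> forall p : nat -> T, (forall j, B (p j) (p j.+1)) ->
  Om (p 0%N) -> M - a <= gap l (p 0%N) -> Om (p m).
Proof.
elim: m => [|m [a1 a10 [k1 IH]]]; first by exists 1 => //; exists 0%N.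
pose b := Num.min a1 (M / 2).
have b0 : 0 < b by rewrite lt_min a10/=; have := M0; lra.
have ba1 : b <= a1 by rewrite ge_min lexx.
have bM : b < M by rewrite gt_min; apply/orP; right; have := M0; lra.
(* One move costs a deficit of at most 3 a + 2 (b / 8), hence the eighths. *)
have [|a2 a20 [k2 flat]] := @near_max_flat (b / 8); first by lra.
pose a := Num.min a2 (b / 8).
have aa2 : a <= a2 by rewrite ge_min lexx.
have ab : a <= b / 8 by rewrite ge_min lexx orbT.
exists a; first by rewrite lt_min a20/=; lra.
exists (k1 + k2).+1 => n ga l nl p pB o0 g0.
case: l => [|l] in nl g0 *; first by move: nl; rewrite addnS.
have nl1 : (n + k1 <= l)%N by lia.
have s0 : slope (p 0%N) < b / 8.
  apply: (flat (l.+1 - k2)%N) => //; first by apply: gap_leW ga => //; lia.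
  by rewrite subnK; [lra|lia].
have aM : a < M by lra.
have gl : gap_le l a by apply: gap_leW ga => //; lia.
have g1 := gap_neighbour aM gl o0 g0 (pB 0%N).
have uv : u l.+1 (p 0%N) < v (p 0%N) by move: g0; rewrite /gap; lra.
have := near_max_slope o0 uv (pB 0%N); rewrite ler_norml => /andP[v1 _].
have g2 : M - b <= gap l (p 1%N) by move: s0 v1; rewrite /slope in g1 *; lra.
apply: (IH n _ l nl1 (fun j => p j.+1)) => //=; last by lra.
  by apply: gap_leW ga => //; lra.
exact: near_max_inside o0 (pB 0%N) bM g2.
Qed.

End limit_gap.

(** If the limit [M] of the largest gaps were positive, a point of [Om] where a
late gap is almost [M] could not have a path of bounded length leaving [Om]. *)
Lemma iterates_converge m :
  (forall x, Om x -> exists p : nat -> T,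
    [/\ p 0%N = x, forall k, B (p k) (p k.+1) & ~ Om (p m)]) ->
  forall e : R, 0 < e -> exists n, forall x, Om x -> v x <= u n x + e.
Proof.
move=> exits e e0; apply: contrapT => nconv.
have far n : exists2 x, Om x & e < gap n x.
  apply: contrapT => h; apply: nconv; exists n => x ox; rewrite leNgt.
  by apply/negP => vx; apply: h; exists x => //; rewrite /gap; lra.
pose bounds := [set b : R | exists n, forall x, Om x -> gap n x <= b].
have hb : has_inf bounds.
  split; last first.
    by exists e => b [n nb]; have [x ox ex] := far n; have := nb x ox; lra.
  exists (C + C), 0%N => x _; have := bv x; have := bu 0%N x.
  by rewrite /gap !ler_norml; lra.
pose M := inf bounds.
have eM : e <= M.
  apply: lb_le_inf; first by case: hb.
  by move=> b [n nb]; have [x ox ex] := far n; have := nb x ox; lra.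
have M0 : 0 < M by lra.
have u_mono' n l x : (n <= l)%N -> u n x <= u l x.
  by move=> /subnK <-; elim: (l - n)%N => // k IH; rewrite addSn (le_trans IH).
have [a a0 [k spread]] := near_max_spreads M0 m.
have [b [n nb] bM] := inf_adherent a0 hb; rewrite -/M in bM.
have ga l : (n <= l)%N -> forall x, Om x -> gap l x <= M + a.
  move=> nl x ox; have := nb x ox; have := u_mono' _ _ x nl; rewrite /gap.
  by lra.
have [x ox gx] : exists2 x, Om x & M - a <= gap (n + k) x.
  apply: contrapT => h; suff : M <= M - a by lra.
  apply: ge_inf; first by case: hb.
  exists (n + k)%N => x ox; rewrite leNgt; apply/negP => gx; apply: h.
  by exists x => //; rewrite ltW.
have [p [p0 pB]] := exits x ox; apply.
by apply: (spread n ga (n + k)%N) => //; rewrite p0.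
Qed.

End convergence.
End neighbourhoods.

(** * The Euclidean norm and the strip *)

Section euclidean.
Context (R : realType) (N : nat).
Implicit Types (x y z : 'rV[R]_N) (Omega : set 'rV[R]_N).

Lemma enorm_ge0 x : 0 <= enorm x.
Proof. exact: sqrtr_ge0. Qed.

Lemma enormZ (a : R) x : enorm (a *: x) = `|a| * enorm x.
Proof.
rewrite /enorm -sqrtr_sqr -sqrtrM ?sqr_ge0// mulr_sumr.
by congr Num.sqrt; apply: eq_bigr => i _; rewrite mxE exprMn.
Qed.

Lemma enormN x : enorm (- x) = enorm x.
Proof. by rewrite -scaleN1r enormZ normrN1 mul1r. Qed.

Lemma enorm0 : enorm (0 : 'rV[R]_N) = 0.
Proof. by rewrite -(scale0r 0) enormZ normr0 mul0r. Qed.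

Lemma normr_coord_le x (i : 'I_N) : `|x ord0 i| <= enorm x.
Proof.
rewrite -sqrtr_sqr ler_wsqrtr// (bigD1 i)//= lerDl.
by apply: sumr_ge0 => j _; exact: sqr_ge0.
Qed.

Lemma enorm_le_mx_norm x : enorm x <= N%:R * `|x|.
Proof.
have x0 : 0 <= `|x| by [].
rewrite -(ger0_norm (mulr_ge0 (ler0n R N) x0)) -sqrtr_sqr ler_wsqrtr//.
apply: (@le_trans _ _ (\sum_(i < N) `|x| ^+ 2)).
  apply: ler_sum => i _; rewrite -(real_normK (num_real _)) lerXn2r ?nnegrE//.
  rewrite [leRHS]mx_normrE.
  exact: (le_bigmax _ (fun ij : 'I_1 * 'I_N => `|x ij.1 ij.2|) (ord0, i)).
rewrite sumr_const card_ord exprMn -[leLHS]mulr_natl ler_wpM2r ?sqr_ge0//.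
by rewrite -natrX ler_nat; case: (N) => // n; rewrite expnS leq_pmulr.
Qed.

Lemma mx_norm_le_enorm x : `|x| <= enorm x.
Proof.
rewrite [leLHS]mx_normrE; apply: bigmax_le => [|[i j] _ /=].
  exact: enorm_ge0.
by rewrite ord1 normr_coord_le.
Qed.

Lemma continuous_enorm : continuous (@enorm R N).
Proof.
move=> x; apply: (@continuous_comp _ _ _ _ Num.sqrt); last exact: sqrt_continuous.
apply: (@continuous_big R 'I_N +%R 0 xpredT) => [y|i _ y].
  exact: add_continuous.
exact: (continuous_comp (@coord_continuous _ _ _ _ _ _) (@exprn_continuous _ _ _)).
Qed.

Lemma open_eball x (r : R) : open (eball x r).
Proof.
have -> : eball x r = (fun y => enorm (y - x)) @^-1` [set s | s < r] by [].
apply: open_comp => [y _|]; last exact: open_lt.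
apply: continuous_comp; last exact: continuous_enorm.
by apply: continuousB; [exact: cvg_id|exact: cst_continuous].
Qed.

Lemma eball_sym (r : R) x y : eball x r y -> eball y r x.
Proof. by rewrite /eball/= -enormN opprB. Qed.

Lemma eball_center x (r : R) : 0 < r -> eball x r x.
Proof. by rewrite /eball/= subrr enorm0. Qed.

Lemma elipschitz_continuous (f : 'rV[R]_N -> R) :
  elipschitz_on setT f -> continuous f.
Proof.
move=> [K fK] x; apply/(@cvgrPdist_lt _ _ _ (nbhs x) (nbhs_filter x)) => e e0.
pose L := `|K| * N%:R + 1; have L0 : 0 < L by rewrite ltr_wpDl ?mulr_ge0.
near=> y; apply: (le_lt_trans (fK x y I I)).
apply: (@le_lt_trans _ _ (L * `|x - y|)).
  apply: (@le_trans _ _ (`|K| * enorm (x - y))).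
    by rewrite ler_wpM2r ?enorm_ge0 ?ler_norm.
  rewrite mulrDl mul1r ler_wpDr// -mulrA ler_wpM2l//.
  exact: enorm_le_mx_norm.
rewrite mulrC -ltr_pdivlMr//; near: y.
apply/nbhs_ballP; exists (e / L); first by rewrite /= divr_gt0.
by move=> y; rewrite -ball_normE.
Unshelve. all: end_near. Qed.

Lemma elipschitz_bounded (A : set 'rV[R]_N) (f : 'rV[R]_N -> R) (b : R) :
  elipschitz_on A f -> (forall x, A x -> `|x| <= b) ->
  exists C, forall x, A x -> `|f x| <= C.
Proof.
move=> [K fK] bA; have [[a Aa]|/set0P/negP] := pselect (A !=set0); last first.
  by rewrite negbK => /eqP ->; exists 0.
exists (`|f a| + `|K| * (N%:R * (b + b))) => x Ax.
rewrite -[f x](addrNK (f a)) addrC (le_trans (ler_normD _ _))// lerD2l.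
rewrite (le_trans (fK _ _ Ax Aa))//.
apply: (@le_trans _ _ (`|K| * enorm (x - a))).
  by rewrite ler_wpM2r ?enorm_ge0 ?ler_norm.
rewrite ler_wpM2l// (le_trans (enorm_le_mx_norm _))// ler_wpM2l//.
by rewrite (le_trans (ler_normB _ _))// lerD ?bA.
Qed.

(** Otherwise the times at which the segment is in [Omega] would be a clopen
subset of [0, 1]. *)
Lemma segment_meets_frontier Omega x y : open Omega -> Omega x -> ~ Omega y ->
  exists2 t : R, 0 <= t <= 1 & frontier Omega (x + t *: (y - x)).
Proof.
move=> oO Ox Oy; apply: contrapT => nf.
pose f (t : R) : 'rV[R]_N := x + t *: (y - x).
have cf : continuous f.
  by move=> t; apply: cvgD; [exact: cvg_cst|apply: cvgZr_tmp; exact: cvg_id].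
have E : `[0, 1] `&` f @^-1` Omega = `[0, 1]%classic.
  apply: segment_connected.
  - by exists 0; split; rewrite /= ?in_itv/= ?lexx ?ler01// /f scale0r addr0.
  - by exists (f @^-1` Omega) => //; apply: open_comp => // t _; exact: cf.
  - exists (f @^-1` closure Omega).
      by apply: preimage_closed => [t _|]; [exact: cf|exact: closed_closure].
    apply/seteqP; split=> t [t01 Ot]; split=> //; first exact: subset_closure.
    apply: contrapT => nOt; apply: nf; exists t; first by rewrite /= in_itv in t01.
    by split=> // /interior_subset.
have : (`[0, 1] `&` f @^-1` Omega) 1.
  by rewrite E /= in_itv/= ler01 lexx.
by move=> [_]; rewrite /f /= scale1r addrC subrK.
Qed.

Lemma edist_le x y (A : set 'rV[R]_N) : A y -> Defs.edist x A <= enorm (x - y).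
Proof.
move=> Ay; apply: ge_inf; last by exists y.
by exists 0 => _ [z _ <-]; exact: enorm_ge0.
Qed.

(** The segment of a move out of [Omega] crosses the boundary, at a distance less
than [eps] from the end of the move. *)
Lemma eball_sub_strip Omega (gamma eps : R) x y : open Omega -> eps <= gamma ->
  Omega x -> eball x eps y -> (Omega `|` strip Omega gamma) y.
Proof.
move=> oO eg Ox xy; have [Oy|Oy] := pselect (Omega y); first by left.
right; split=> //; have [t /andP[t0 t1] ft] := segment_meets_frontier oO Ox Oy.
apply: (le_trans (edist_le y ft)); apply: le_trans eg; apply/ltW.
apply: le_lt_trans xy.
have -> : y - (x + t *: (y - x)) = (1 - t) *: (y - x).
  by rewrite scalerBl scale1r opprD addrA.
by rewrite enormZ ger0_norm ?subr_ge0// ler_piMl ?enorm_ge0// gerBl.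
Qed.

(** Moving in a fixed direction by half the allowed step leaves a bounded set
after a number of moves that does not depend on the starting point. *)
Lemma bounded_escape Omega (b eps : R) : (0 < N)%N -> 0 < eps ->
  (forall x, Omega x -> enorm x <= b) ->
  exists n, forall x, Omega x -> exists p : nat -> 'rV[R]_N,
    [/\ p 0%N = x, forall k, eball (p k) eps (p k.+1) & ~ Omega (p n)].
Proof.
move=> N0 e0 bO; pose i := Ordinal N0; pose v : 'rV[R]_N := delta_mx ord0 i.
have v1 : enorm v <= 1.
  rewrite -[leRHS]sqrtr1 ler_wsqrtr// (bigD1 i)//= mxE !eqxx expr1n.
  by rewrite big1 ?addr0// => j ji; rewrite mxE (negbTE ji) expr0n.
pose n := (Num.truncn (4 * b / eps)).+1.
have nb : 2 * b < n%:R * (eps / 2).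
  have : 4 * b < n%:R * eps by rewrite -ltr_pdivrMr// truncnS_gt.
  by lra.
exists n => x Ox; exists (fun k => x + (k%:R * (eps / 2)) *: v); split.
- by rewrite mul0r scale0r addr0.
- move=> k; rewrite /eball/= opprD addrACA subrr add0r -scalerBl -mulrBl.
  rewrite -natr1 addrAC subrr add0r mul1r enormZ ger0_norm; last lra.
  by have : eps / 2 * enorm v <= eps / 2; [rewrite ler_piMr//; lra|lra].
move=> /bO bn; have := le_trans (normr_coord_le _ i) bn.
have := le_trans (normr_coord_le _ i) (bO _ Ox).
by rewrite !mxE !eqxx mulr1 !ler_norml => /andP[+ _] /andP[_]; lra.
Qed.

Lemma strip_bounded Omega (gamma b : R) : (0 < N)%N -> Omega !=set0 ->
  open Omega -> (forall x, Omega x -> enorm x <= b) ->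
  forall x, strip Omega gamma x -> `|x| <= b + gamma + 2.
Proof.
move=> N0 [a Oa] oO bO x [Ox dx].
have [z fz] : frontier Omega !=set0.
  have [t _ ft] := segment_meets_frontier oO Oa Ox.
  by exists (a + t *: (x - a)).
have [_ [y [cy _] <-] xy] : exists2 d, [set enorm (x - y) | y in frontier Omega] d &
    d < Defs.edist x (frontier Omega) + 1.
  apply: inf_adherent => //; split; first by exists (enorm (x - z)), z.
  by exists 0 => _ [? _ <-]; exact: enorm_ge0.
have [y' [Oy' yy']] := cy _ (nbhsx_ballx y 1 ltr01).
have -> : x = (x - y) + (y - y') + y' by rewrite addrA !subrK.
have h1 := le_trans (mx_norm_le_enorm _) (bO _ Oy').
have h2 := mx_norm_le_enorm (x - y).
have h3 : `|y - y'| < 1 by move: yy'; rewrite -ball_normE.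
have := ler_normD (x - y + (y - y')) y'; have := ler_normD (x - y) (y - y').
by lra.
Qed.

End euclidean.

(** * Borel strategies and stopping rules *)

(** Take the value attached to the first set of the cover that contains the
point. *)
Lemma measurable_choice d d' (T : measurableType d) (T' : measurableType d')
    (A : nat -> set T) (y : nat -> T') :
  (forall n, measurable (A n)) -> (forall x, exists n, A n x) ->
  exists2 s : T -> T', measurable_fun setT s &
    forall x, exists2 n, A n x & s x = y n.
Proof.
move=> mA covA.
have covD x : exists n, seqDU A n x.
  have [n Anx] := covA x.
  have [m _ Dm] : (\bigcup_k seqDU A k) x by rewrite -seqDU_bigcup_eq; exists n.
  by exists m.
have [idx hidx] : exists idx : T -> nat, forall x, seqDU A (idx x) x.
  by exists (fun x => sval (cid (covD x))) => x; exact: (svalP (cid (covD x))).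
exists (y \o idx); last first.
  by move=> x; exists (idx x) => //; exact: (subset_seqDU (hidx x)).
have -> : [set: T] = \bigcup_n seqDU A n.
  by apply/seteqP; split=> // x _; exists (idx x).
have mD n : measurable (seqDU A n) by exact: seqDU_measurable.
apply/measurable_fun_bigcup => // n.
apply: (eq_measurable_fun (cst (y n))); last exact: measurable_cst.
move=> x; rewrite inE => Dx /=; congr y.
by apply: (@trivIset_seqDU _ A n (idx x)) => //; exists x; split.
Qed.

Section borel.
Context (R : realType) (N : nat) (eps : R).
Hypothesis eps0 : 0 < eps.
Let V := 'rV[R]_N.
Let B (x : V) := eball x eps.
Implicit Types (u : V -> R) (x y : V).

Let Brefl x : B x x. Proof. exact: eball_center. Qed.

Lemma open_measurable_rV (A : set V) : open A -> measurable A.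
Proof. exact: sub_sigma_algebra. Qed.

Lemma lower_semicontinuous_measurable u :
  (forall c, open [set x | c < u x]) -> measurable_fun setT u.
Proof.
move=> ou; apply: (measurability _ (RGenOInfty.measurableE R)).
move=> _ [_ [c ->] <-]; rewrite setTI preimage_itvoy.
by apply: open_measurable_rV; exact: ou.
Qed.

Lemma continuous_measurable_rV u : continuous u -> measurable_fun setT u.
Proof.
move=> cu; apply: lower_semicontinuous_measurable => c.
by apply: (@open_comp _ _ u [set t | c < t]) => [x _|]; [exact: cu|exact: open_gt].
Qed.

(** The supremum over open balls is lower semicontinuous whatever [u] is: a
superlevel set is the union of the balls centred at the points where [u] is
large. *)
Lemma measurable_nbhd_sup C u : bounded_by C u -> measurable_fun setT (nbhd_sup B u).
Proof.
move=> bu; apply: lower_semicontinuous_measurable => c.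
rewrite (_ : [set x | _] = \bigcup_(y in [set y | c < u y]) eball y eps).
  by apply: bigcup_open => y _; exact: open_eball.
apply/seteqP; split=> x /=.
  rewrite -subr_gt0 => c0; have [y xy] := nbhd_sup_near Brefl x bu c0.
  by rewrite opprB addrC subrK => cy; exists y => //; exact: eball_sym.
move=> [y cy yx]; apply: lt_le_trans cy _.
by apply: (le_nbhd_sup Brefl bu); exact: eball_sym.
Qed.

Lemma measurable_midrange C u : bounded_by C u -> measurable_fun setT (midrange B u).
Proof.
move=> bu; have bNu : bounded_by C (fun y => - u y) by move=> x; rewrite normrN.
rewrite (_ : midrange B u = fun x =>
  2^-1 * nbhd_sup B u x + 2^-1 * - nbhd_sup B (fun y => - u y) x).
  apply: measurable_funD; apply: measurable_funM => //.
    exact: measurable_nbhd_sup bu.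
  by apply: measurableT_comp => //; exact: measurable_nbhd_sup bNu.
by apply/funext => x; rewrite /midrange nbhd_infE.
Qed.

Lemma rational_ball (x : V) (e : R) : 0 < e ->
  exists (q : 'rV[rat]_N) (k : nat),
    ball (map_mx ratr q : V) k.+1%:R^-1 x /\
    ball (map_mx ratr q : V) k.+1%:R^-1 `<=` ball x e.
Proof.
move=> e0; pose k := Num.truncn (2 / e).
have k2 : k.+1%:R^-1 + k.+1%:R^-1 <= e.
  have k1 : k.+1%:R^-1 <= e / 2.
    rewrite -[leRHS]invrK lef_pV2 ?posrE ?invr_gt0 ?divr_gt0//.
    by rewrite invf_div ltW// truncnS_gt.
  by rewrite [leRHS]splitr lerD.
have [q qx] : exists q : 'rV[rat]_N, forall j,
    ratr (q ord0 j) \in `]x ord0 j, x ord0 j + k.+1%:R^-1[.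
  have h j : exists a : rat, ratr a \in `]x ord0 j, x ord0 j + k.+1%:R^-1[.
    by apply: rat_in_itvoo; rewrite ltrDl invr_gt0.
  exists (\row_j sval (cid (h j))) => j; rewrite mxE; exact: (svalP (cid (h j))).
have bx : ball (map_mx ratr q : V) k.+1%:R^-1 x.
  split=> [|i j]; first by rewrite invr_gt0.
  rewrite mxE ord1 -ball_normE/=.
  by have := qx j; move: k.+1%:R^-1 => r; rewrite in_itv/= ltr_norml; lra.
exists q, k; split=> // z qz; apply: (le_ball k2).
exact: ball_triangle (ball_sym bx) qz.
Qed.

(** The candidates are indexed by the triples of a rational centre, a radius
and a level: they are countably many, so they can be tried in order, and the
tests compare a lower semicontinuous function with constants. *)
Lemma measurable_near_maximizer C u (e : R) : bounded_by C u -> 0 < e ->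
  exists2 s : V -> V, measurable_fun setT s &
    forall x, B x (s x) /\ nbhd_sup B u x - e < u (s x).
Proof.
move=> bu e0; pose h := e / 2; have h0 : 0 < h by rewrite divr_gt0.
pose I := ('rV[rat]_N * nat * int)%type.
pose cell (i : I) := ball (map_mx ratr i.1.1 : V) i.1.2.+1%:R^-1 `&`
  [set y | i.2%:~R * h < u y].
pose y n : V := if unpickle n is Some i then xget 0 (cell i) else 0.
pose A n := eball (y n) eps `&` [set x | nbhd_sup B u x < u (y n) + e].
have [||s ms hs] := @measurable_choice _ _ V V A y.
- move=> n; apply: measurableI; first by apply: open_measurable_rV; exact: open_eball.
  rewrite -[X in measurable X]setTI.
  rewrite (_ : [set x | _] = nbhd_sup B u @^-1` `]-oo, u (y n) + e[).
    by apply: (measurable_nbhd_sup bu).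
  by apply/seteqP; split=> x /=; rewrite in_itv.
- move=> x; have [z xz uz] := nbhd_sup_near Brefl x bu h0.
  have /nbhs_ballP[r r0 zr] : nbhs z (B x).
    by apply: open_nbhs_nbhs; split=> //; exact: open_eball.
  have [q [k [qz qr]]] := rational_ball z r0.
  (* a level between the supremum minus e and the supremum minus e / 2 *)
  pose m := Num.ceil ((nbhd_sup B u x - e) / h).
  have /andP[m1 m2] := ceil_itv ((nbhd_sup B u x - e) / h).
  rewrite -/m ler_pdivrMr// in m2.
  rewrite -/m ltr_pdivlMr// intrB mulrBl mul1r in m1.
  have zc : cell (q, k, m) z by split=> //=; move: m1 uz; rewrite /h; lra.
  have [qy my] := xgetPex 0 (ex_intro (cell (q, k, m)) z zc).
  exists (pickle (q, k, m)); rewrite /A /y pickleK; split.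
    by apply: eball_sym; apply: zr; exact: qr.
  by move: my; rewrite /=; lra.
exists s => // x; have [n [xn sn] ->] := hs x; split; first exact: eball_sym.
by move: sn; rewrite /=; lra.
Qed.

Definition markov_strategy (s : nat -> V -> V)
    (ms : forall k, measurable_fun setT (s k))
    (sB : forall k x, B x (s k x)) : strategy N eps.
Proof.
apply: (@Strategy _ _ _ (fun k h => s k h.2)) => [k|k h]; last exact: sB.
exact: measurableT_comp (ms k) (@measurable_snd _ _ _ _).
Defined.

(** The stopping regions vary with the stage because the remaining horizon
does. *)
Section hitting.
Context (n : nat) (G : nat -> set V).
Hypothesis mG : forall k, measurable (G k).

Definition hitting_time (p : play R N) : nat :=
  find (fun k => `[< G k (pos p k) >]) (iota 0 n).

Lemma hitting_timeP p k : hitting_time p = k <->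
  [/\ (k <= n)%N, k = n \/ G k (pos p k) & forall j, (j < k)%N -> ~ G j (pos p j)].
Proof.
rewrite /hitting_time; set a := fun k => _.
have nthi j : (j < n)%N -> nth 0%N (iota 0 n) j = j by move=> jn; rewrite nth_iota.
have fn := find_size a (iota 0 n); rewrite size_iota in fn.
split=> [<-|[kn hk nG]].
  split=> // [|j jf].
    have [ftn|nf] := ltnP (find a (iota 0 n)) n; last first.
      by left; apply/eqP; rewrite eqn_leq fn.
    right; have := @nth_find _ 0%N a (iota 0 n).
    by rewrite has_find size_iota ftn nthi// => /(_ isT)/asboolP.
  have := before_find 0%N jf; rewrite nthi ?(leq_trans jf)//.
  by move=> /asboolPn.
apply/eqP; rewrite eqn_leq; apply/andP; split.
  have [->//|kn'] := eqVneq k n.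
  rewrite leqNgt; apply/negP => /(before_find 0%N).
  rewrite nthi ?ltn_neqAle ?kn'// => /asboolPn.
  by case: hk => // /eqP; rewrite (negbTE kn').
rewrite leqNgt; apply/negP => fk; apply: (nG _ fk).
have := @nth_find _ 0%N a (iota 0 n).
by rewrite has_find size_iota (leq_trans fk)// nthi ?(leq_trans fk)// => /(_ isT)/asboolP.
Qed.

Definition hitting_rule : stopping_rule R N.
Proof.
apply: (@StoppingRule _ _ hitting_time) => k.
exists ([set h | (k <= n)%N] `&` ([set h | k = n] `|` snd @^-1` G k) `&`
    \bigcap_(j in [set: 'I_k])
      [set h : history R N k | ~ G j (tnth h.1 j).1]).
  have mcst (P : Prop) : measurable [set h : history R N k | P].
    have [p|p] := pselect P.
      by rewrite (_ : [set h | P] = setT)//; apply/seteqP; split.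
    by rewrite (_ : [set h | P] = set0)//; apply/seteqP; split.
  apply: measurableI; first apply: measurableI => //.
    apply: measurableU => //; rewrite -[X in measurable X]setTI.
    by apply: measurable_snd.
  apply: fin_bigcap_measurable => // j _.
  apply: measurableC; rewrite -[X in measurable X]setTI.
  have mf : measurable_fun [set: history R N k] (fun h => (tnth h.1 j).1).
    apply: (measurableT_comp (@measurable_fst _ _ _ _)).
    exact: (measurableT_comp (@measurable_tnth _ _ _ _) (@measurable_fst _ _ _ _)).
  exact: mf.
apply/seteqP; split=> p /=.
  move=> /hitting_timeP[kn hk nG]; split=> // j _ /=.
  by rewrite tnth_mktuple; exact: nG.
move=> [[kn hk] nG]; apply/hitting_timeP; split=> // j jk.
by have := nG (Ordinal jk) I; rewrite /= tnth_mktuple.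
Defined.

End hitting.
End borel.

(** * Averages over finitely many coin tosses *)

Definition upd (c : nat -> bool) (k : nat) (b : bool) : nat -> bool :=
  fun j => if j == k then b else c j.
Arguments upd : simpl never.

Lemma upd_same c k b : upd c k b k = b.
Proof. by rewrite /upd eqxx. Qed.

Lemma upd_agree (c : nat -> bool) k b j : (j < k)%N -> upd c k b j = c j.
Proof. by move=> jk; rewrite /upd ltn_eqF. Qed.

(** The fan theorem: a time that is finite for every sequence of tosses and
decided by the tosses made so far is bounded. Otherwise one could extend, toss
by toss, a prefix that has continuations with arbitrarily large times. *)
Lemma fan_bound (T : (nat -> bool) -> nat) :
  (forall c c', (forall j, (j < T c)%N -> c j = c' j) -> T c' = T c) ->
  exists n, forall c, (T c <= n)%N.
Proof.
move=> Tpre; apply: contrapT => unb.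
pose bad k c := forall n, exists2 c' : nat -> bool,
  (forall j, (j < k)%N -> c' j = c j) & (n < T c')%N.
have bad0 : bad 0%N xpredT.
  move=> n; apply: contrapT => h; apply: unb; exists n => c.
  by rewrite leqNgt; apply/negP => nc; apply: h; exists c.
pose next k c := if pselect (bad k.+1 (upd c k true)) then upd c k true
                 else upd c k false.
have badS k c : bad k c -> bad k.+1 (next k c).
  rewrite /next => bc; case: pselect => //= nb n.
  (* The times are bounded by some m after tossing true, so the continuations
     with larger times toss false. *)
  have [m mb] : exists m, forall c' : nat -> bool,
      (forall j, (j < k.+1)%N -> c' j = upd c k true j) -> (T c' <= m)%N.
    apply: contrapT => h; apply: nb => m; apply: contrapT => h'; apply: h.
    exists m => c' hc'; rewrite leqNgt; apply/negP => mc'; apply: h'.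
    by exists c'.
  have [c' c'c nc'] := bc (maxn m n); rewrite gtn_max in nc'.
  case/andP: nc' => mc' nc'; exists c' => // j; rewrite ltnS leq_eqVlt.
  case/orP => [/eqP ->|jk]; last by rewrite upd_agree// c'c.
  rewrite upd_same; apply: contrapT => c'k.
  suff h : forall j, (j < k.+1)%N -> c' j = upd c k true j.
    by have := mb _ h; rewrite leqNgt mc'.
  move=> i; rewrite ltnS leq_eqVlt => /orP[/eqP ->|ik].
    by rewrite upd_same; case: (c' k) c'k.
  by rewrite upd_agree// c'c.
pose f := fix f k := if k is k'.+1 then next k' (f k') else xpredT.
have badf k : bad k (f k) by elim: k => // k IH; exact: badS.
have fS k j : (j < k)%N -> f k.+1 j = f k j.
  by move=> jk; rewrite /= /next; case: (pselect _) => h /=; rewrite upd_agree.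
pose c k := f k.+1 k.
have fc k j : (j < k)%N -> f k j = c j.
  elim: k => // k IH; rewrite ltnS leq_eqVlt => /orP[/eqP ->//|jk].
  by rewrite fS// IH.
have [c' c'c] := badf (T c) (T c).
have -> : T c' = T c by apply: Tpre => j jT; rewrite c'c// fc.
by rewrite ltnn.
Qed.

Section averages.
Context (R : realType).
Implicit Types (g : (nat -> bool) -> R) (c : nat -> bool).

(** The conditional expectation of [g], given that the first [k] tosses are
those of [c], when [g] depends on the first [k + n] tosses only. *)
Fixpoint coin_avg n k g c : R :=
  if n is n'.+1 then
    2^-1 * coin_avg n' k.+1 g (upd c k true) + 2^-1 * coin_avg n' k.+1 g (upd c k false)
  else g c.

Lemma coin_avgN n k g c : coin_avg n k (fun c => - g c) c = - coin_avg n k g c.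
Proof. by elim: n k c => //= n IH k c; rewrite !IH !mulrN opprD. Qed.

Lemma coin_avg_supermartingale (Z : nat -> (nat -> bool) -> R) (e : nat -> R) n c :
  (forall k c, (k < n)%N ->
    2^-1 * Z k.+1 (upd c k true) + 2^-1 * Z k.+1 (upd c k false) <= Z k c + e k) ->
  coin_avg n 0 (Z n) c <= Z 0%N c + \sum_(k < n) e k.
Proof.
move=> ZS; suff h m k c' : (k + m)%N = n ->
    coin_avg m k (Z n) c' <= Z k c' + \sum_(k <= j < n) e j.
  by have := h n 0%N c (add0n n); rewrite big_mkord.
elim: m k c' => [|m IH] k c' /=; first by rewrite addn0 => ->; rewrite big_geq ?addr0.
move=> kmn; have kn : (k < n)%N by lia.
rewrite big_ltn// addrA.
have h1 := IH k.+1 (upd c' k true) (etrans (addSnnS _ _) kmn).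
have h2 := IH k.+1 (upd c' k false) (etrans (addSnnS _ _) kmn).
by have := ZS k c' kn; lra.
Qed.

Lemma measurable_coin k b : measurable [set w : measurableTypeR R | coin w k = b].
Proof.
rewrite (_ : [set w | _] = \bigcup_(z in [set z : int | odd (absz z) = b])
    [set` `[z%:~R / 2 ^+ k.+1, (z + 1)%:~R / 2 ^+ k.+1[]).
  rewrite bigcup_mkcond; apply: countable_bigcupT_measurable => // z.
  by case: ifP => _; [exact: measurable_itv|exact: measurable0].
have p0 : 0 < 2 ^+ k.+1 :> R by rewrite exprn_gt0.
have fP (w : R) (z : int) :
    (w \in `[z%:~R / 2 ^+ k.+1, (z + 1)%:~R / 2 ^+ k.+1[) <->
    Num.floor (2 ^+ k.+1 * w) = z.
  rewrite in_itv/= ler_pdivrMr// ltr_pdivlMr// mulrC; split.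
    by move=> h; exact: floor_def.
  by move=> <-; exact: floor_itv.
apply/seteqP; split=> w; rewrite /coin /=.
  by move=> wb; exists (Num.floor (2 ^+ k.+1 * w)) => //; exact/fP.
by move=> [z zb /fP ->].
Qed.

Definition cylinder k c : set (measurableTypeR R) :=
  [set w | forall j, (j < k)%N -> coin w j = c j].

Lemma measurable_cylinder k c : measurable (cylinder k c).
Proof.
rewrite (_ : cylinder k c = \bigcap_(j in `I_k) [set w | coin w j = c j])//.
by apply: fin_bigcap_measurable => // j _; exact: measurable_coin.
Qed.

Lemma cylinderS k c :
  cylinder k c = cylinder k.+1 (upd c k true) `|` cylinder k.+1 (upd c k false).
Proof.
apply/seteqP; split=> [w wc|w].
  case wk : (coin w k); [left|right] => j; rewrite ltnS leq_eqVlt => /orP[/eqP ->|jk];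
    by rewrite ?upd_same ?upd_agree// wc.
by case=> wc j jk; have := wc j (ltnW jk); rewrite upd_agree.
Qed.

Lemma integral_cylinder g n k c :
  (forall c c', (forall j, (j < k + n)%N -> c j = c' j) -> g c = g c') ->
  measurable_fun (cylinder k c) (fun w => (g (coin w))%:E) /\
  (\int[coin_prob R]_(w in cylinder k c) (g (coin w))%:E =
   (2^-1 ^+ k * coin_avg n k g c)%:E)%E.
Proof.
elim: n k c => [|n IH] k c gpre.
  have gE : {in cylinder k c, cst (g c)%:E =1 (fun w => (g (coin w))%:E)}.
    move=> w; rewrite inE => wc /=; congr EFin; apply: gpre => j.
    by rewrite addn0 => jk; rewrite wc.
  split; first exact: eq_measurable_fun gE (measurable_cst _).
  rewrite -(eq_integral _ _ gE) integral_cst; last exact: measurable_cylinder.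
  by rewrite mulrC EFinM /=; congr (_ * _)%E; exact: fair_coins.
rewrite cylinderS.
have h := IH k.+1 _ (fun c c' H => gpre c c' (fun j (jk : (j < k + n.+1)%N) =>
  H j (etrans (congr1 _ (addSnnS _ _)) jk))).
have [m1 i1] := h (upd c k true); have [m2 i2] := h (upd c k false).
have mU := measurable_cylinder k.+1 (upd c k true).
have mV := measurable_cylinder k.+1 (upd c k false).
have m12 := (measurable_funU (fun w => (g (coin w))%:E) mU mV).2 (conj m1 m2).
split=> //; rewrite integral_setU//.
  by rewrite i1 i2 -EFinD /= exprSr -!mulrA mulrDr.
apply/disj_setPS => w [wt wf]; have := wt k (ltnSn k); rewrite (wf k (ltnSn k)).
by rewrite !upd_same.
Qed.

Lemma expectation_coin_avg g n c :
  (forall c c', (forall j, (j < n)%N -> c j = c' j) -> g c = g c') ->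
  ('E_(coin_prob R)[fun w => g (coin w)] = (coin_avg n 0 g c)%:E)%E.
Proof.
move=> gpre; rewrite unlock; have [_] := @integral_cylinder g n 0 c gpre.
rewrite expr0 mul1r => <-; congr (integral _ _ _).
by apply/seteqP; split.
Qed.

End averages.

(** * The game along a sequence of tosses *)

Section plays.
Context (R : realType) (N : nat) (eps : R) (Gamma : set 'rV[R]_N).
Context (tau : stopping_rule R N) (x0 : 'rV[R]_N) (SI SII : strategy N eps).
Implicit Types (c : nat -> bool) (p : play R N).

Let run c := play_of x0 SI SII c.
Let hist c k := play_history x0 SI SII c k.
Let T c := terminal_time Gamma tau (run c).

Lemma terminal_timeP p : over_at Gamma tau p (terminal_time Gamma tau p) /\
  forall j, over_at Gamma tau p j -> (terminal_time Gamma tau p <= j)%N.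
Proof.
have ex : exists k, `[< over_at Gamma tau p k >].
  by exists (tau p); apply/asboolP; right.
have [m /asboolP mo mmin] := ex_minnP ex.
pose D := [set k | over_at Gamma tau p k /\
  forall j, over_at Gamma tau p j -> (k <= j)%N].
have Dm : D m by split=> // j jo; apply: mmin; apply/asboolP.
exact: getPex (ex_intro D m Dm).
Qed.

Lemma play_history_agree c c' k : (forall j, (j < k)%N -> c j = c' j) ->
  play_history x0 SI SII c k = play_history x0 SI SII c' k.
Proof.
elim: k => //= k IH cc'; rewrite IH ?cc'// => j jk.
by rewrite cc'// ltnW.
Qed.

Lemma play_agree c c' k j : (forall j, (j < k)%N -> c j = c' j) -> (j <= k)%N ->
  run c j = run c' j.
Proof.
move=> cc' jk; rewrite /run /play_of (@play_history_agree c c')// => i ij.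
by rewrite cc'// (leq_trans ij).
Qed.

Lemma over_at_agree c c' k j : (forall j, (j < k)%N -> c j = c' j) -> (j <= k)%N ->
  over_at Gamma tau (run c) j <-> over_at Gamma tau (run c') j.
Proof.
move=> cc' jk; have pE i : (i <= j)%N -> run c i = run c' i.
  by move=> ij; apply: play_agree cc' _; exact: leq_trans jk.
have hE : past j (run c) = past j (run c').
  rewrite /past /pos pE//; congr pair; apply: eq_from_tnth => i.
  by rewrite !tnth_mktuple pE// ltnW.
have [A _ tA] := stop_time_adapted tau j.
have tE p : (tau p = j) = A (past j p).
  exact: (congr1 (fun S : set (play R N) => S p) tA).
by rewrite /over_at /pos pE// !tE hE.
Qed.

(** Stopping rules are adapted and the position at stage [k] is determined by the
first [k] tosses. *)
Lemma terminal_time_agree c c' k : (forall j, (j < k)%N -> c j = c' j) ->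
  (T c <= k)%N -> T c' = T c.
Proof.
move=> cc' Tk; have [ov m1] := terminal_timeP (run c).
have [ov2 m2] := terminal_timeP (run c').
have T' : (T c' <= T c)%N by apply: m2; apply/(over_at_agree cc').
apply/eqP; rewrite eqn_leq T'/=; apply: m1.
by apply/(over_at_agree cc') => //; exact: leq_trans Tk.
Qed.

(** This reduces the expectation to a finite average, even though Player I does
not have to announce any horizon. *)
Lemma terminal_time_bounded : exists n, forall c, (T c <= n)%N.
Proof. by apply: fan_bound => c c' cc'; exact: terminal_time_agree cc' _. Qed.

Lemma posS c k b :
  pos (run (upd c k b)) k.+1 = if b then SI k (hist c k) else SII k (hist c k).
Proof.
rewrite /pos /run /play_of /= upd_same.
by rewrite (@play_history_agree (upd c k b) c)// => j; exact: upd_agree.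
Qed.

Lemma pos_eball c k : eball (pos (run c) k) eps (pos (run c) k.+1).
Proof. by rewrite /pos /run /play_of /=; case: ifP => _; exact: action_ball. Qed.

Section estimate.
Context (f : 'rV[R]_N -> R).

(** A value process [V] that dominates the payoff when the game ends and that is
a supermartingale up to the errors [e] before bounds the mean payoff: stop the
process at the end of the game. *)
Lemma mean_payoff_le (V : nat -> 'rV[R]_N -> R) (e : nat -> R) n c0 :
  (forall k, 0 <= e k) -> (forall c, (T c <= n)%N) ->
  (forall c, f (pos (run c) (T c)) <= V (T c) (pos (run c) (T c))) ->
  (forall c k, (k < n)%N -> (k < T c)%N ->
    2^-1 * V k.+1 (SI k (hist c k)) + 2^-1 * V k.+1 (SII k (hist c k)) <=
    V k (hist c k).2 + e k) ->
  coin_avg n 0 (fun c => f (pos (run c) (T c))) c0 <= V 0%N x0 + \sum_(k < n) e k.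
Proof.
move=> e0 Tn fV stepV.
pose Z k c := if (T c <= k)%N then f (pos (run c) (T c)) else V k (pos (run c) k).
have ZV k c : (k <= T c)%N -> Z k c <= V k (pos (run c) k).
  move=> kT; rewrite /Z; case: leqP => // Tk.
  have TE : T c = k by apply/eqP; rewrite eqn_leq Tk.
  by have := fV c; rewrite TE.
have -> : (fun c => f (pos (run c) (T c))) = Z n.
  by apply/funext => c; rewrite /Z Tn.
apply: le_trans (coin_avg_supermartingale (Z := Z) (e := e) _ _) _.
  move=> k c kn; have agr b j : (j < k)%N -> c j = upd c k b j.
    by move=> jk; rewrite upd_agree.
  have [Tk|kT] := leqP (T c) k.
    have ZE b : Z k.+1 (upd c k b) = Z k c.
      rewrite /Z (terminal_time_agree (agr b) Tk) Tk leqW//.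
      by rewrite /pos -(play_agree (agr b) Tk).
    by rewrite !ZE; have := e0 k; lra.
  have kT' b : (k < T (upd c k b))%N.
    rewrite ltnNge; apply/negP => Tk.
    have agr' j : (j < k)%N -> upd c k b j = c j by move=> jk; rewrite upd_agree.
    by have := terminal_time_agree agr' Tk => TE; rewrite TE ltnNge Tk in kT.
  have h b := ZV k.+1 (upd c k b) (kT' b).
  have -> : Z k c = V k (hist c k).2 by rewrite /Z leqNgt kT.
  have := stepV c k kn kT; have := h true; have := h false; rewrite !posS /=.
  by lra.
by rewrite lerD2r; exact: ZV.
Qed.

End estimate.

(** Until the game ends every move starts in [Omega], so it is enough that no
single move jumps over [Gamma]. *)
Lemma pos_inside (Omega : set 'rV[R]_N) c k :
  (forall x y, Omega x -> eball x eps y -> (Omega `|` Gamma) y) ->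
  (Omega `|` Gamma) x0 -> (k <= T c)%N -> (Omega `|` Gamma) (pos (run c) k).
Proof.
move=> OG x0OG; elim: k => // k IH kT.
have [Ok|Gk] := IH (ltnW kT); first exact: OG Ok (pos_eball c k).
have [_ m1] := terminal_timeP (run c).
have : (T c <= k)%N by apply: m1; left.
by rewrite leqNgt kT.
Qed.

Lemma pos_not_over c k : (k < T c)%N -> ~ Gamma (pos (run c) k) /\ tau (run c) <> k.
Proof.
move=> kT; have [_ m1] := terminal_timeP (run c).
by split=> h; have := m1 k; rewrite leqNgt kT => /(_ _)/negP []//; [left|right].
Qed.

Lemma expected_payoff_avg (F Psi : 'rV[R]_N -> R) n c0 : (forall c, (T c <= n)%N) ->
  expected_payoff Gamma F Psi x0 tau SI SII =
  (coin_avg n 0 (fun c => final_payoff Gamma F Psi (pos (run c) (T c))) c0)%:E.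
Proof.
move=> Tn; apply: (@expectation_coin_avg R
  (fun c => final_payoff Gamma F Psi (pos (run c) (T c)))) => c c' cc'.
rewrite (terminal_time_agree cc' (Tn c)).
by rewrite /pos (play_agree cc' (Tn c)).
Qed.

(** Stopping rules are finite on every play, so the infinite penalties never
apply and the two players' payoffs coincide. *)
Lemma game_terminates_as : terminates_as Gamma x0 tau SI SII.
Proof. by apply: aeW => w; exists (tau (run (coin w))); right. Qed.

Lemma V_IE (F Psi : 'rV[R]_N -> R) :
  V_I Gamma F Psi x0 tau SI SII = expected_payoff Gamma F Psi x0 tau SI SII.
Proof. by rewrite /V_I; case: asboolP => // /(_ game_terminates_as). Qed.

Lemma V_IIE (F Psi : 'rV[R]_N -> R) :
  V_II Gamma F Psi x0 tau SI SII = expected_payoff Gamma F Psi x0 tau SI SII.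
Proof. by rewrite /V_II; case: asboolP => // /(_ game_terminates_as). Qed.

End plays.

(** * The obstacle problem and the values of the game *)

Section obstacle.
Context (R : realType) (N : nat) (eps : R) (Omega Gamma : set 'rV[R]_N).
Context (F Psi : 'rV[R]_N -> R) (C : R).
Hypothesis eps0 : 0 < eps.
Hypothesis disjoint_Omega_Gamma : forall x, Omega x -> ~ Gamma x.
Hypothesis eball_inside :
  forall x y, Omega x -> eball x eps y -> (Omega `|` Gamma) y.
Hypothesis C0 : 0 <= C.
Hypothesis F_bound : forall x, Gamma x -> `|F x| <= C.
Hypothesis Psi_bound : forall x, Omega x -> `|Psi x| <= C.

Let V := 'rV[R]_N.
Let B (x : V) := eball x eps.
Implicit Types (g v w : V -> R) (x y : V).

Let Brefl x : B x x. Proof. exact: eball_center. Qed.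
Let Bsym x y : B x y -> B y x. Proof. exact: eball_sym. Qed.

(** The value 0 away from [Omega] and [Gamma], which the game never visits, keeps
all functions bounded. *)
Definition extend g x : R :=
  if x \in Gamma then F x else if x \in Omega then g x else 0.

Lemma extend_Gamma g x : Gamma x -> extend g x = F x.
Proof. by move=> Gx; rewrite /extend mem_set. Qed.

Lemma extend_Omega g x : Omega x -> extend g x = g x.
Proof.
by move=> Ox; rewrite /extend memNset ?mem_set//; exact: disjoint_Omega_Gamma.
Qed.

Lemma extend_notin g g' x : ~ Omega x -> extend g x = extend g' x.
Proof. by move=> Ox; rewrite /extend (memNset Ox). Qed.

Lemma extend_bounded g : (forall x, Omega x -> `|g x| <= C) -> bounded_by C (extend g).
Proof.
move=> gC x; rewrite /extend; case: ifPn => [/set_mem /F_bound//|_].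
by case: ifPn => [/set_mem /gC//|_]; rewrite normr0.
Qed.

Lemma extend_le g g' : (forall x, Omega x -> g x <= g' x) ->
  forall x, extend g x <= extend g' x.
Proof.
move=> gg' x; have [Ox|Ox] := pselect (Omega x); last by rewrite (extend_notin g g').
by rewrite !extend_Omega// gg'.
Qed.

Definition obstacle_op v : V -> R :=
  extend (fun x => Num.max (Psi x) (midrange B v x)).

Lemma obstacle_op_bounded v : bounded_by C v -> bounded_by C (obstacle_op v).
Proof.
move=> bv; apply: extend_bounded => x Ox.
by rewrite /Num.max; case: ifP => _; [exact: normr_midrange|exact: Psi_bound].
Qed.

Lemma obstacle_op_le v w : bounded_by C v -> bounded_by C w ->
  (forall x, v x <= w x) -> forall x, obstacle_op v x <= obstacle_op w x.
Proof.
move=> bv bw vw; apply: extend_le => x _.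
by rewrite ge_max !le_max lexx/= (midrange_le Brefl bv bw) ?orbT.
Qed.

(** The value of the game in which Player I has to stop by stage [n]. *)
Definition horizon_value n : V -> R := iter n obstacle_op (extend Psi).

Lemma horizon_value_bounded n : bounded_by C (horizon_value n).
Proof.
elim: n => [|n IH]; last exact: obstacle_op_bounded.
exact: extend_bounded.
Qed.

Lemma horizon_value_mono n x : horizon_value n x <= horizon_value n.+1 x.
Proof.
elim: n x => [|n IH]; first by apply: extend_le => x _; rewrite le_max lexx.
exact: (obstacle_op_le (horizon_value_bounded n) (horizon_value_bounded n.+1) IH).
Qed.

Lemma horizon_value_Gamma n x : Gamma x -> horizon_value n x = F x.
Proof. by case: n => [|n] Gx; rewrite /horizon_value/= /obstacle_op extend_Gamma. Qed.

Lemma Psi_le_horizon_value n x : Omega x -> Psi x <= horizon_value n x.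
Proof.
by case: n => [|n] Ox; rewrite /horizon_value/= /obstacle_op extend_Omega// le_max lexx.
Qed.

Definition supersolution w := bounded_by C w /\ forall x, obstacle_op w x <= w x.

Definition least_supersolution x : R := inf [set w x | w in supersolution].
Let W := least_supersolution.

Lemma supersolution_cst : supersolution (cst C).
Proof.
have bC : bounded_by C (cst C : V -> R) by move=> x; rewrite ger0_norm.
split=> // x; apply: le_trans (obstacle_op_bounded bC x); exact: ler_norm.
Qed.

Lemma has_inf_supersolution x : has_inf [set w x | w in supersolution].
Proof.
split; first by exists C, (cst C) => //; exact: supersolution_cst.
by exists (- C) => _ [w [bw _] <-]; have := bw x; rewrite ler_norml => /andP[].
Qed.

Lemma least_supersolution_le w x : supersolution w -> W x <= w x.
Proof. by move=> sw; apply: ge_inf; [case: (has_inf_supersolution x)|exists w]. Qed.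

Lemma least_supersolution_bounded : bounded_by C W.
Proof.
move=> x; rewrite ler_norml (least_supersolution_le x supersolution_cst) andbT.
apply: lb_le_inf; first by case: (has_inf_supersolution x).
by move=> _ [w [bw _] <-]; have := bw x; rewrite ler_norml => /andP[].
Qed.

(** The fixed point argument of Knaster and Tarski. *)
Lemma least_supersolution_fix x : obstacle_op W x = W x.
Proof.
have bW := least_supersolution_bounded; have bTW := obstacle_op_bounded bW.
have TW y : obstacle_op W y <= W y.
  apply: lb_le_inf; first by case: (has_inf_supersolution y).
  move=> _ [w sw <-]; have [bw Tw] := sw; apply: le_trans (Tw y).
  by apply: obstacle_op_le => // z; exact: least_supersolution_le.
apply/le_anti; rewrite TW/=; apply: least_supersolution_le; split=> //.
exact: obstacle_op_le.
Qed.

Lemma least_supersolution_Omega x : Omega x ->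
  W x = Num.max (Psi x) (midrange B W x).
Proof. by move=> Ox; rewrite -least_supersolution_fix /obstacle_op extend_Omega. Qed.

Lemma least_supersolution_Gamma x : Gamma x -> W x = F x.
Proof. by move=> Gx; rewrite -least_supersolution_fix /obstacle_op extend_Gamma. Qed.

Lemma ball_midrangeE w x : bounded_by C w -> ball_midrange eps w x = (midrange B w x)%:E.
Proof.
move=> bw; have [n0 ub] := bounded_by_has_sup Brefl x bw.
have [_ lb] := bounded_by_has_inf Brefl x bw.
rewrite /ball_midrange.
have -> : [set (w y)%:E | y in eball x eps] = [set z%:E | z in w @` B x].
  by rewrite image_comp.
by rewrite ereal_sup_EFin// ereal_inf_EFin.
Qed.

Lemma least_supersolution_solves : discrete_obstacle_solution eps Omega Gamma F Psi W.
Proof.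
have bW := least_supersolution_bounded; have WO := least_supersolution_Omega.
split=> [x Ox|x Ox|x Gx|x Ox PW].
- by rewrite ball_midrangeE// lee_fin [leRHS]WO// le_max lexx orbT.
- by rewrite [leRHS]WO// le_max lexx.
- exact: least_supersolution_Gamma.
- rewrite ball_midrangeE// [in LHS]WO//; congr EFin; apply/max_idPr.
  by move: PW; rewrite WO// lt_max ltxx/= => /ltW.
Qed.

Lemma geometric_errors (d : R) n : 0 < d -> \sum_(k < n) d / 2 ^+ k.+1 <= d.
Proof.
move=> d0; suff -> : \sum_(k < n) d / 2 ^+ k.+1 = d - d / 2 ^+ n.
  by rewrite gerBl divr_ge0 ?exprn_ge0// ltW.
elim: n => [|n IH]; first by rewrite big_ord0 expr0 divr1 subrr.
by rewrite big_ord_recr /= IH exprS; field.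
Qed.

Lemma near_maximizing_strategy (v : nat -> V -> R) (e : nat -> R) :
  (forall k, bounded_by C (v k)) -> (forall k, 0 < e k) ->
  exists S : strategy N eps, forall k (h : history R N k),
    nbhd_sup B (v k) h.2 - e k < v k (S k h).
Proof.
move=> bv e0.
have sel k := cid2 (measurable_near_maximizer eps0 (bv k) (e0 k)).
pose ms k := s2valP (sel k); pose hs k := s2valP' (sel k).
by exists (markov_strategy ms (fun k x => (hs k x).1)) => k h; have [] := hs k h.2.
Qed.

Lemma near_minimizing_strategy (v : nat -> V -> R) (e : nat -> R) :
  (forall k, bounded_by C (v k)) -> (forall k, 0 < e k) ->
  exists S : strategy N eps, forall k (h : history R N k),
    v k (S k h) < nbhd_inf B (v k) h.2 + e k.
Proof.
move=> bv e0; have bNv k : bounded_by C (fun x => - v k x).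
  by move=> x; rewrite normrN; exact: bv.
have [S hS] := near_maximizing_strategy bNv e0.
by exists S => k h; have := hS k h; rewrite nbhd_infE; lra.
Qed.

Lemma final_payoff_Gamma x : Gamma x -> final_payoff Gamma F Psi x = F x.
Proof. by move=> Gx; rewrite /final_payoff mem_set. Qed.

Lemma final_payoff_Omega x : Omega x -> final_payoff Gamma F Psi x = Psi x.
Proof. by move=> Ox; rewrite /final_payoff memNset//; exact: disjoint_Omega_Gamma. Qed.

(** Player II aims at almost minimal points of the solution. The horizon is up to
Player I, so the errors have to be summable over all rounds. *)
Lemma u_II_le x0 : (Omega `|` Gamma) x0 -> (u_II eps Gamma F Psi x0 <= (W x0)%:E)%E.
Proof.
move=> x0OG; have bW := least_supersolution_bounded.
apply/lee_addgt0Pr => d d0.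
pose e k : R := d / 2 ^+ k.+1.
have e0 k : 0 < e k by rewrite divr_gt0// exprn_gt0.
have [SII hS] := @near_minimizing_strategy (fun=> W) e (fun=> bW) e0.
apply: (@le_trans _ _ (ereal_sup [set V_II Gamma F Psi x0 s.1 s.2 SII
    | s in [set: stopping_rule R N * strategy N eps]])).
  by apply: ereal_inf_lbound; exists SII.
apply: ge_ereal_sup => _ [[tau SI] _ <-]; rewrite V_IIE /=.
have [n Tn] := terminal_time_bounded Gamma tau x0 SI SII.
rewrite (expected_payoff_avg F Psi xpredT Tn) -EFinD lee_fin.
apply: le_trans (mean_payoff_le (V := fun=> W) (e := e) xpredT _ Tn _ _) _.
- by move=> k; exact: ltW.
- move=> c; have [Ox|Gx] := pos_inside eball_inside x0OG
      (leqnn (terminal_time Gamma tau (play_of x0 SI SII c))).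
    by rewrite final_payoff_Omega// least_supersolution_Omega// le_max lexx.
  by rewrite final_payoff_Gamma// least_supersolution_Gamma.
- move=> c k _ kT; set h := play_history _ _ _ _ _.
  have [nG _] := pos_not_over kT.
  have [Ox|//] := pos_inside eball_inside x0OG (ltnW kT).
  have mW : midrange B W h.2 <= W h.2.
    by rewrite [leRHS]least_supersolution_Omega// le_max lexx orbT.
  have h2 := hS k h; have h1 := le_nbhd_sup Brefl bW (action_ball SI h).
  by have := e0 k; move: mW; rewrite /midrange; lra.
by rewrite lerD2l; exact: geometric_errors.
Qed.

Hypothesis Psi_continuous : continuous Psi.

(** Player I aims at almost maximal points of the value with the remaining
horizon, and stops as soon as that value is the obstacle. *)
Lemma horizon_value_le_u_I n x0 : (Omega `|` Gamma) x0 ->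
  ((horizon_value n x0)%:E <= u_I eps Gamma F Psi x0)%E.
Proof.
move=> x0OG; apply/lee_addgt0Pr => d d0.
pose e k : R := d / 2 ^+ k.+1.
have e0 k : 0 < e k by rewrite divr_gt0// exprn_gt0.
pose U k := horizon_value (n - k.+1).
have bU k : bounded_by C (U k) by exact: horizon_value_bounded.
have [SI hS] := near_maximizing_strategy bU e0.
pose G k := [set x | midrange B (U k) x <= Psi x].
have mG k : measurable (G k).
  rewrite -[X in measurable X]setTI; apply: measurable_fun_le => //.
    by have := measurable_midrange eps0 (bU k).
  exact: continuous_measurable_rV.
pose tau := hitting_rule n mG.
rewrite -leeBlDr//; apply: (@le_trans _ _ (ereal_inf [set V_I Gamma F Psi x0 tau SI SII
    | SII in [set: strategy N eps]])); last first.
  by apply: ereal_sup_ubound; exists (tau, SI).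
apply/ereal_infP => _ [SII _ <-]; rewrite V_IE.
have Ttau c : (terminal_time Gamma tau (play_of x0 SI SII c)
    <= tau (play_of x0 SI SII c))%N.
  by have [_] := terminal_timeP Gamma tau (play_of x0 SI SII c); apply; right.
have Tn c : (terminal_time Gamma tau (play_of x0 SI SII c) <= n)%N.
  have /hitting_timeP[tn _ _] := erefl (hitting_time n G (play_of x0 SI SII c)).
  exact: leq_trans (Ttau c) tn.
rewrite (expected_payoff_avg F Psi xpredT Tn) -EFinB lee_fin.
have := mean_payoff_le (f := fun x => - final_payoff Gamma F Psi x)
  (V := fun k x => - horizon_value (n - k) x) (e := e) xpredT _ Tn _ _.
rewrite coin_avgN subn0 => key.
suff : - coin_avg n 0 (fun c => final_payoff Gamma F Psi (pos (play_of x0 SI SII c)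
    (terminal_time Gamma tau (play_of x0 SI SII c)))) xpredT <=
    - horizon_value n x0 + \sum_(k < n) e k.
  by have := @geometric_errors d n d0; rewrite -/e; lra.
apply: key => [k|c|c k kn kT]; first exact: ltW.
- set t := terminal_time _ _ _; set x := pos _ _; rewrite lerN2.
  have [Gx|nG] := pselect (Gamma x).
    by rewrite final_payoff_Gamma// horizon_value_Gamma.
  have [Ox|//] := pos_inside eball_inside x0OG (leqnn t).
  rewrite final_payoff_Omega//.
  have [[//|tt] _] := terminal_timeP Gamma tau (play_of x0 SI SII c).
  (* Player I has stopped at stage t, at the horizon or on entering G t; in both
     cases the value with the remaining horizon is the obstacle. *)
  have /hitting_timeP[tn [tE|Gt] _] := tt.
    rewrite -/t in tE; rewrite tE subnn /horizon_value/= extend_Omega//.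
  rewrite -/t in tn Gt.
  have [->|tn'] := eqVneq t n; first by rewrite subnn /horizon_value/= extend_Omega.
  have tnS : (n - t = (n - t.+1).+1)%N by lia.
  rewrite tnS /horizon_value iterS /obstacle_op extend_Omega//.
  by rewrite ge_max lexx/=.
- set h := play_history _ _ _ _ _; have [nG _] := pos_not_over kT.
  have [Ox|//] := pos_inside eball_inside x0OG (ltnW kT).
  have /hitting_timeP[_ _ /(_ k)] := erefl (hitting_time n G (play_of x0 SI SII c)).
  move=> /(_ (leq_trans kT (Ttau c))) /negP; rewrite -ltNge => Gk.
  have nkS : (n - k = (n - k.+1).+1)%N by lia.
  have uk : horizon_value (n - k) h.2 = midrange B (U k) h.2.
    rewrite nkS /horizon_value iterS /obstacle_op extend_Omega//.
    by apply/max_idPr; exact: ltW.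
  have h1 := hS k h; have h2 := nbhd_inf_le Brefl (bU k) (action_ball SII h).
  rewrite uk /midrange -!/(U k _); have := e0 k; lra.
Qed.

Lemma u_I_le_u_II x0 : (u_I eps Gamma F Psi x0 <= u_II eps Gamma F Psi x0)%E.
Proof.
apply: ge_ereal_sup => _ [s _ <-]; apply/ereal_infP => _ [SII _ <-].
apply: (@le_trans _ _ (V_I Gamma F Psi x0 s.1 s.2 SII)).
  by apply: ereal_inf_lbound; exists SII.
by rewrite V_IE -V_IIE; apply: ereal_sup_ubound; exists s.
Qed.

Context (m : nat).
Hypothesis escape : forall x, Omega x -> exists p : nat -> V,
  [/\ p 0%N = x, forall k, B (p k) (p k.+1) & ~ Omega (p m)].

Lemma horizon_value_converges (e : R) : 0 < e ->
  exists n, forall x, Omega x -> W x <= horizon_value n x + e.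
Proof.
apply: (iterates_converge Brefl Bsym least_supersolution_bounded
  horizon_value_bounded horizon_value_mono _ _ _ escape).
- move=> n x Ox; rewrite /horizon_value iterS {2}/obstacle_op extend_Omega//.
  by rewrite le_max lexx orbT.
- move=> n x Ox uW; have := least_supersolution_Omega Ox.
  have := Psi_le_horizon_value n Ox; rewrite -/W.
  by move: uW; rewrite /Num.max; case: ifP => _ => h1 h2 h3; lra.
- move=> n x y Ox xy Oy; have [//|Gy] := eball_inside Ox xy.
  by rewrite least_supersolution_Gamma// horizon_value_Gamma.
Qed.

Lemma le_u_I x0 : (Omega `|` Gamma) x0 -> ((W x0)%:E <= u_I eps Gamma F Psi x0)%E.
Proof.
move=> x0OG; apply/lee_addgt0Pr => e e0.
have [n hn] := horizon_value_converges e0.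
apply: (@le_trans _ _ ((horizon_value n x0)%:E + e%:E)%E); last first.
  by rewrite leeD2r// horizon_value_le_u_I.
rewrite -EFinD lee_fin; have [Ox|Gx] := x0OG; first exact: hn.
by rewrite least_supersolution_Gamma// horizon_value_Gamma// lerDl ltW.
Qed.

Lemma game_value x0 : (Omega `|` Gamma) x0 ->
  u_I eps Gamma F Psi x0 = (W x0)%:E /\ u_II eps Gamma F Psi x0 = (W x0)%:E.
Proof.
move=> x0OG; have h1 := le_u_I x0OG; have h2 := u_II_le x0OG.
have h3 := u_I_le_u_II x0.
by split; apply/le_anti; rewrite ?h1 ?h2 ?(le_trans h3)// (le_trans h1).
Qed.

End obstacle.

(** * The value of the game *)

Theorem theorem1 (R : realType) (N : nat) (hN : (0 < N)%N)
  (Omega : set 'rV[R]_N) (hOmega : bounded_smooth_domain Omega)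
  (gamma : R) (hgamma : 0 < gamma)
  (F Psi : 'rV[R]_N -> R)
  (hF : elipschitz_on (strip Omega gamma) F)
  (hPsi : elipschitz_on [set: 'rV[R]_N] Psi)
  (hPsiF : forall x, strip Omega gamma x -> Psi x <= F x)
  (eps : R) (heps : 0 < eps <= gamma) :
  let Gamma := strip Omega gamma in
  exists u : 'rV[R]_N -> R,
    (forall x, (Omega `|` Gamma) x ->
       u_I eps Gamma F Psi x = (u x)%:E /\ u_II eps Gamma F Psi x = (u x)%:E) /\
    discrete_obstacle_solution eps Omega Gamma F Psi u.
Proof.
move=> Gamma; have /andP[eps0 eps_gamma] := heps.
have [nOmega oOmega _ [b bOmega] _] := hOmega.
have disj x : Omega x -> ~ Gamma x by move=> Ox [].
have inside x y : Omega x -> eball x eps y -> (Omega `|` Gamma) y.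
  exact: eball_sub_strip.
have [CF FC] := elipschitz_bounded hF (strip_bounded hN nOmega oOmega bOmega).
have hPsi' : elipschitz_on Omega Psi.
  by have [K PK] := hPsi; exists K => x y _ _; exact: PK.
have [CP PC] := elipschitz_bounded hPsi'
  (fun x Ox => le_trans (mx_norm_le_enorm x) (bOmega x Ox)).
pose C := Num.max 0 (Num.max CF CP).
have C0 : 0 <= C by rewrite le_max lexx.
have FC' x : Gamma x -> `|F x| <= C by move=> /FC; rewrite !le_max => ->; rewrite orbT.
have PC' x : Omega x -> `|Psi x| <= C by move=> /PC; rewrite !le_max => ->; rewrite !orbT.
have [m escape] := bounded_escape hN eps0 bOmega.
exists (least_supersolution eps Omega Gamma F Psi C); split.
  move=> x; exact: game_value (elipschitz_continuous hPsi) _ escape _.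
exact: least_supersolution_solves.
Qed.
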